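(* For $\mu>0$ let $\varphi_\mu:=f_1+\mu f_2$ and $\gamma(\mu):=\operatorname{arg\,min}_{x\in\mathcal{M}}\varphi_\mu(x)$. Assume that: (i) $\mathcal{M}$ is a smooth and compact Riemannian manifold; (ii) $f_1,f_2:\mathcal{M}\to\mathbb{R}$ are twice continuously differentiable; (iii) for every $\mu>0$, the problem $\min_{x\in\mathcal{M}}\varphi_\mu(x)$ has a unique solution, i.e., $\gamma(\mu)$ is a singleton; (iv) for every $\mu>0$, the Riemannian Hessian $H_\mu(\gamma(\mu)):=\operatorname{Hess}\varphi_\mu(\gamma(\mu))$ is invertible as a linear operator on $T_{\gamma(\mu)}\mathcal{M}$. Then the mapping $\mu\mapsto\gamma(\mu)$, from $(0,\infty)$ to $\mathcal{M}$, is continuously differentiable, and its derivative at $\mu$ (a tangent vector in $T_{\gamma(\mu)}\mathcal{M}$, denoted by $\dot\gamma(\mu)$) is given by $$\dot\gamma(\mu)=-\bigl(H_\mu(\gamma(\mu))\bigr)^{-1}\operatorname{grad}f_2(\gamma(\mu)).$$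
   Context: When the set of global minimizers $\gamma(\mu)$ is a singleton, it is identified with its unique element. $\operatorname{grad}$ denotes the Riemannian gradient and $\operatorname{Hess}\varphi(x):T_x\mathcal{M}\to T_x\mathcal{M}$, $\operatorname{Hess}\varphi(x)[\xi]=\nabla_\xi\operatorname{grad}\varphi$, the Riemannian Hessian with respect to the Levi-Civita connection $\nabla$. *)

(* Defs.v *)
From HB Require Import structures.
From mathcomp Require Import all_boot all_order all_algebra.
From mathcomp Require Import all_classical all_reals all_analysis.

Set Implicit Arguments.
Unset Strict Implicit.
Unset Printing Implicit Defensive.

Import Order.TTheory GRing.Theory Num.Theory numFieldNormedType.Exports.

Local Open Scope classical_set_scope.
Local Open Scope ring_scope.

(* The domains V used below are finite-dimensional and the sets U are open, so
   this is the usual notion of a C^k map on U.                                *)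
Fixpoint Ck_on (R : realType) (V W : normedModType R) (k : nat) (U : set V)
    (f : V -> W) : Prop :=
  if k is k'.+1 then
    (forall x, U x -> differentiable f x) /\
    (forall v, Ck_on k' U (fun x => 'D_v f x))
  else forall x, U x -> {for x, continuous f}.

(* [chart_inv] is only meaningful on the open set [chart_map @` chart_dom].   *)
Record chart (R : realType) (n : nat) (T : topologicalType) := Chart {
  chart_dom : set T;
  chart_map : T -> 'rV[R]_n;
  chart_inv : 'rV[R]_n -> T;
  chart_dom_open : open chart_dom;
  chart_im_open : open (chart_map @` chart_dom);
  chart_mapK : forall p, chart_dom p -> chart_inv (chart_map p) = p;
  chart_map_cont : forall p, chart_dom p -> {for p, continuous chart_map};
  chart_inv_cont : forall x, (chart_map @` chart_dom) x ->
    {for x, continuous chart_inv}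
}.

(* Smooth manifolds without boundary, of dimension n.                         *)
Record smooth_manifold (R : realType) (n : nat) := SmoothManifold {
  carrier :> topologicalType;
  carrier_hausdorff : hausdorff_space carrier;
  carrier_second_countable : @second_countable carrier;
  atlas : set (chart R n carrier);
  atlas_cover : forall p, exists c, atlas c /\ chart_dom c p;
  atlas_smooth : forall c d, atlas c -> atlas d -> forall k,
    Ck_on k (chart_map c @` (chart_dom c `&` chart_dom d))
      (fun x => chart_map d (chart_inv c x))
}.

Section Manifold.
Context (R : realType) (n : nat) (M : smooth_manifold R n).

Definition chart_around (p : M) (c : chart R n M) : Prop :=
  atlas c /\ chart_dom c p.

(* A tangent vector at p is the family of its coordinates in the charts of the
   atlas around p, related by the differentials of the transition maps. Charts
   that are not around p carry the dummy value 0, so that two tangent vectors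
   with the same coordinates are equal.                                       *)
Definition tangent_family (p : M) : {pred chart R n M -> 'rV[R]_n} :=
  fun v => `[< (forall c d, chart_around p c -> chart_around p d ->
      v d = 'd (fun x => chart_map d (chart_inv c x)) (chart_map c p) (v c)) /\
    (forall c, ~ chart_around p c -> v c = 0) >].

Lemma tangent_family_submod p : submod_closed (tangent_family p).
Proof.
split=> [|a u v /asboolP[u1 u2] /asboolP[v1 v2]]; apply/asboolP; split.
- by move=> c d _ _; rewrite [RHS]linear0.
- by [].
- by move=> c d pc pd; rewrite [RHS]linearP -(u1 c d)// -(v1 c d).
- by move=> c pc; rewrite -[LHS]/(a *: u c + v c) u2// v2// scaler0 addr0.
Qed.

HB.instance Definition _ p := GRing.isSubmodClosed.Build R
  (chart R n M -> 'rV[R]_n) (tangent_family p) (tangent_family_submod p).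

Record tangent (p : M) := Tangent {
  coords :> chart R n M -> 'rV[R]_n;
  _ : coords \in tangent_family p
}.

HB.instance Definition _ p := [isSub for @coords p].
HB.instance Definition _ p := [Choice of tangent p by <:].
HB.instance Definition _ p :=
  [SubChoice_isSubLmodule of tangent p by <:].

Definition vfield := forall p : M, tangent p.

Definition Ck_fun (k : nat) (U : set M) (f : M -> R) : Prop :=
  forall c, atlas c -> Ck_on k (chart_map c @` (chart_dom c `&` U))
    (fun x => f (chart_inv c x)).

Definition Ck_vfield (k : nat) (U : set M) (X : vfield) : Prop :=
  forall c, atlas c -> Ck_on k (chart_map c @` (chart_dom c `&` U))
    (fun x => X (chart_inv c x) c).

Definition pref_chart (p : M) : chart R n M := sval (cid (atlas_cover p)).

(* The value does not depend on the chart around p used to compute it.        *)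
Definition dfun (f : M -> R) (p : M) (xi : tangent p) : R :=
  let c := pref_chart p in
  'd (fun x => f (chart_inv c x)) (chart_map c p) (xi c).

Record riemannian_metric := RiemannianMetric {
  metric :> forall p : M, tangent p -> tangent p -> R;
  metric_sym : forall p (u v : tangent p), metric u v = metric v u;
  metric_linear : forall p (a : R) (u v w : tangent p),
    metric (a *: u + v) w = a * metric u w + metric v w;
  metric_pos : forall p (u : tangent p), u != 0 -> 0 < metric u u;
  metric_smooth : forall (U : set M) (X Y : vfield), open U ->
    (forall k, Ck_vfield k U X) -> (forall k, Ck_vfield k U Y) ->
    forall k, Ck_fun k U (fun p => metric (X p) (Y p))
}.

(* [grad g f p] is the Riesz representative of the differential of f at p.    *)
Definition grad (g : riemannian_metric) (f : M -> R) : vfield :=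
  fun p => xget 0 [set G : tangent p | forall xi, g p G xi = dfun f xi].

(* [nabla p X xi] is the covariant derivative of the field X at p in the
   direction xi. The axioms bear on fields that are only C^1 on some open set U
   (such as gradients of C^2 functions); the value of nabla at p is
   unconstrained, apart from linearity in xi, on fields which are not C^1 around
   p. Taking for h in the Leibniz rule the indicator function of U shows that
   [nabla p X] only depends on the germ of X at p.                            *)
Record connection := Connection {
  nabla :> forall p : M, vfield -> {linear tangent p -> tangent p};
  nabla_add : forall (U : set M) (X Y : vfield), open U ->
    Ck_vfield 1 U X -> Ck_vfield 1 U Y -> forall p, U p ->
    forall xi : tangent p,
    nabla p (fun q => X q + Y q) xi = nabla p X xi + nabla p Y xi;
  nabla_leibniz : forall (U : set M) (h : M -> R) (X : vfield), open U ->
    Ck_fun 1 U h -> Ck_vfield 1 U X -> forall p, U p ->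
    forall xi : tangent p,
    nabla p (fun q => h q *: X q) xi = dfun h xi *: X p + h p *: nabla p X xi;
  nabla_Ck : forall (k : nat) (U : set M) (X Y : vfield), open U ->
    Ck_vfield k U X -> Ck_vfield k.+1 U Y ->
    Ck_vfield k U (fun p => nabla p Y (X p))
}.

(* nabla_X Y - nabla_Y X = [X, Y], where the Lie bracket is described by its
   action X(Y f) - Y(X f) on functions.                                       *)
Definition torsion_free (nabla : connection) : Prop :=
  forall (U : set M) (X Y : vfield) (f : M -> R), open U ->
    Ck_vfield 1 U X -> Ck_vfield 1 U Y -> Ck_fun 2 U f -> forall p, U p ->
    dfun f (nabla p Y (X p) - nabla p X (Y p)) =
    dfun (fun q => dfun f (Y q)) (X p) - dfun (fun q => dfun f (X q)) (Y p).

Definition metric_compatible (g : riemannian_metric) (nabla : connection) :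
    Prop :=
  forall (U : set M) (Y Z : vfield), open U ->
    Ck_vfield 1 U Y -> Ck_vfield 1 U Z -> forall p, U p ->
    forall xi : tangent p,
    dfun (fun q => g q (Y q) (Z q)) xi =
    g p (nabla p Y xi) (Z p) + g p (Y p) (nabla p Z xi).

Definition levi_civita (g : riemannian_metric) (nabla : connection) : Prop :=
  torsion_free nabla /\ metric_compatible g nabla.

Definition Hess (g : riemannian_metric) (nabla : connection) (f : M -> R)
    (p : M) : {linear tangent p -> tangent p} :=
  nabla p (grad g f).

(* The inverse map of F when F is bijective.                                  *)
Definition tangent_inv (p : M) (F : tangent p -> tangent p) :
    tangent p -> tangent p :=
  'pinv_(fun=> 0) setT F.

Definition argmin (f : M -> R) : set M :=
  [set x | forall y, f x <= f y].

(* C^1 curves on an open set D of parameters.                                 *)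
Definition C1_curve (D : set R) (gamma : R -> M) : Prop :=
  (forall t, D t -> {for t, continuous gamma}) /\
  (forall c, atlas c -> Ck_on 1 (D `&` gamma @^-1` chart_dom c)
    (fun t => chart_map c (gamma t))).

(* v is the derivative of gamma at t.                                         *)
Definition has_velocity (gamma : R -> M) (t : R) (v : tangent (gamma t)) :
    Prop :=
  forall c, chart_around (gamma t) c ->
    is_derive t 1 (fun s => chart_map c (gamma s)) (v c).

End Manifold.

(* Main.v *)
From HB Require Import structures.
Require Import Defs.
From mathcomp Require Import all_boot all_order all_algebra.
From mathcomp Require Import all_classical all_reals all_analysis.
From mathcomp Require Import lra.
Import Order.TTheory GRing.Theory Num.Theory numFieldNormedType.Exports.
Set Implicit Arguments.
Unset Strict Implicit.
Unset Printing Implicit Defensive.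
Local Open Scope classical_set_scope.
Local Open Scope ring_scope.

(** The implicit function theorem would give a C^1 branch of critical points
    through each minimizer, and one would then have to identify it with gamma.
    It is shorter to observe that gamma itself is continuous, because
    differentiability at a point then follows from the critical point equation
    by a direct estimate.

    Continuity ([argmin_continuous]): as the manifold is compact, it suffices
    that every cluster point of gamma(s) as s tends to mu be gamma(mu); such a
    point minimizes the limit function, whose minimizer is unique.

    Derivative: in a chart, write F1 and F2 for the two functions and x(s) for
    the coordinates of gamma(s). The equation grad F1(x(s)) + s grad F2(x(s)) = 0
    says that K := grad(F1 + t F2) satisfies K(x(s)) = (t - s) grad F2(x(s)). If
    the Hessian matrix A of F1 + t F2 at x(t) is invertible, then
    K(x(s)) = (x(s) - x(t)) A + o(|x(s) - x(t)|), and since x is continuous at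
    t this forces x'(t) = - grad F2(x(t)) A^-1 ([is_derive_zero_curve],
    [critical_curve_derive]). The right-hand side depends continuously on t by
    Cramer's rule, so that x is C^1 ([critical_curve_C1]).

    Geometry: the matrix A represents the Riemannian Hessian. Differentiating
    <grad f, E> = df(E) for a coordinate field E by metric compatibility gives
    <Hess f [xi], E> + <grad f, nabla_xi E> = xi(df(E)), where the second term
    vanishes at a critical point and the right-hand side is an entry of xi A
    ([Hess_critical_coord]). Hence an injective Riemannian Hessian makes A
    invertible ([hess_mx_unitmx]), and the coordinates of the solution xi of
    Hess f [xi] = grad f2 are grad F2 A^-1. Metric compatibility only speaks of
    C^1 fields, so the gradient of a C^2 function must first be shown to be C^1
    ([Ck_grad]): its coordinates are the partial derivatives times the inverse
    of the matrix of the metric. *)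

(** * Calculus of C^k maps *)

Section Locality.
Context {R : realType} {V W : normedModType R}.

Lemma near_eq_differentiable (f h : V -> W) (x : V) :
  (\near x, f x = h x) -> differentiable f x -> differentiable h x.
Proof.
move=> fh /diff_locallyP[dfc dfE].
suff hE : h \o shift x = cst (h x) + 'd f x +o_ 0 id.
  have dhE := diff_unique dfc hE.
  by apply/diff_locallyP; rewrite dhE; split.
apply/eqaddoP => e e0; move/eqaddoP : dfE => /(_ e e0).
have fhx := nbhs_singleton fh.
move: fh; rewrite (near_shift 0) subr0 => fh.
by apply: filterS2 fh => y /= fh; rewrite !fctE /= -fh -fhx.
Qed.

Lemma near_eq_diff (f h : V -> W) (x : V) :
  (\near x, f x = h x) -> differentiable f x -> 'd f x = 'd h x :> (V -> W).
Proof.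
move=> fh df; apply/funext => v.
rewrite -!deriveE//; first exact: near_eq_derive.
exact: near_eq_differentiable fh df.
Qed.

End Locality.

Section CkCalculus.
Context {R : realType} {V : normedModType R} (U : set V) (Uo : open U).

Lemma open_near_eq {T : Type} (f h : V -> T) x :
  (forall y, U y -> f y = h y) -> U x -> \near x, f x = h x.
Proof.
by move=> fh Ux; near=> y; apply: fh; near: y; exact: open_nbhs_nbhs.
Unshelve. all: by end_near. Qed.

Lemma Ck_on_ext {W : normedModType R} k (f h : V -> W) :
  (forall x, U x -> f x = h x) -> Ck_on k U f -> Ck_on k U h.
Proof.
elim: k f h => [|k IHk] f h fh /=.
  move=> fc x Ux; have := fc x Ux; rewrite /prop_for/continuous_at fh//.
  by apply: cvg_trans; apply: near_eq_cvg; exact: open_near_eq.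
move=> [df dfk]; split=> [x Ux|v].
  exact: near_eq_differentiable (open_near_eq fh Ux) (df x Ux).
by apply: IHk (dfk v) => x Ux; exact/near_eq_derive/open_near_eq.
Qed.

Lemma Ck_onS {W : normedModType R} k (f : V -> W) :
  Ck_on k.+1 U f -> Ck_on k U f.
Proof.
elim: k f => [|k IHk] f [df dfk].
  by move=> x Ux; exact/differentiable_continuous/df.
by split=> // v; apply: IHk; exact: dfk.
Qed.

Lemma Ck_on_subset {W : normedModType R} k (U' : set V) (f : V -> W) :
  U' `<=` U -> Ck_on k U f -> Ck_on k U' f.
Proof.
move=> U'U; elim: k f => [|k IHk] f /=; first by move=> fc x /U'U; exact: fc.
by move=> [df dfk]; split=> [x /U'U|v]; [exact: df | exact/IHk/dfk].
Qed.

Lemma Ck_on_cst {W : normedModType R} k (a : W) : Ck_on k U (fun=> a).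
Proof.
elim: k a => [|k IHk] a /=; first by move=> x _; exact: cvg_cst.
split=> [x _|v]; first exact: differentiable_cst.
by apply: Ck_on_ext (IHk 0) => x _; rewrite derive_cst.
Qed.

Lemma Ck_onD {W : normedModType R} k (f h : V -> W) :
  Ck_on k U f -> Ck_on k U h -> Ck_on k U (fun x => f x + h x).
Proof.
elim: k f h => [|k IHk] f h /=.
  by move=> fc hc x Ux; apply: cvgD; [exact: fc | exact: hc].
move=> [df dfk] [dh dhk]; split=> [x Ux|v].
  by apply: differentiableD; [exact: df | exact: dh].
apply: Ck_on_ext (IHk _ _ (dfk v) (dhk v)) => x Ux.
by rewrite [RHS]deriveD//; apply: diff_derivable; [exact: df | exact: dh].
Qed.

Lemma Ck_onM k (f h : V -> R) :
  Ck_on k U f -> Ck_on k U h -> Ck_on k U (fun x => f x * h x).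
Proof.
elim: k f h => [|k IHk] f h.
  by move=> fc hc x Ux; apply: cvgM; [exact: fc | exact: hc].
move=> fk hk; have [df dfk] := fk; have [dh dhk] := hk; split=> [x Ux|v].
  by apply: differentiableM; [exact: df | exact: dh].
apply: Ck_on_ext (Ck_onD (IHk _ _ (Ck_onS fk) (dhk v))
  (IHk _ _ (Ck_onS hk) (dfk v))) => x Ux.
by rewrite [RHS]deriveM//; apply: diff_derivable; [exact: df | exact: dh].
Qed.

Lemma Ck_on_sum k {I : Type} (r : seq I) (P : pred I) (F : I -> V -> R) :
  (forall i, P i -> Ck_on k U (F i)) ->
  Ck_on k U (fun x => \sum_(i <- r | P i) F i x).
Proof.
move=> Fk; elim: r => [|i r IHr].
  by apply: Ck_on_ext (Ck_on_cst k 0) => x _; rewrite big_nil.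
have [Pi|nPi] := boolP (P i).
  by apply: Ck_on_ext (Ck_onD (Fk i Pi) IHr) => x _; rewrite big_cons Pi.
by apply: Ck_on_ext IHr => x _; rewrite big_cons (negbTE nPi).
Qed.

Lemma Ck_on_prod k {I : Type} (r : seq I) (P : pred I) (F : I -> V -> R) :
  (forall i, P i -> Ck_on k U (F i)) ->
  Ck_on k U (fun x => \prod_(i <- r | P i) F i x).
Proof.
move=> Fk; elim: r => [|i r IHr].
  by apply: Ck_on_ext (Ck_on_cst k (1 : R)) => x _; rewrite big_nil.
have [Pi|nPi] := boolP (P i).
  by apply: Ck_on_ext (Ck_onM (Fk i Pi) IHr) => x _; rewrite big_cons Pi.
by apply: Ck_on_ext IHr => x _; rewrite big_cons (negbTE nPi).
Qed.

Lemma Ck_onV k (f : V -> R) : (forall x, U x -> f x != 0) ->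
  Ck_on k U f -> Ck_on k U (fun x => (f x)^-1).
Proof.
move=> f0; elim: k => [|k IHk].
  by move=> fc x Ux; apply: cvgV; [exact: f0 | exact: fc].
move=> fk; have [df dfk] := fk; split=> [x Ux|v].
  by apply: differentiableV; [exact: df | exact: f0].
have Vk := IHk (Ck_onS fk).
apply: Ck_on_ext (Ck_onM (Ck_onM (Ck_on_cst k (-1 : R)) (Ck_onM Vk Vk)) (dfk v)).
move=> x Ux; rewrite deriveV; [|exact: f0|exact/diff_derivable/df].
by rewrite expr2 invfM mulN1r.
Qed.

Section Matrices.
Variables (n : nat) (k : nat).

Lemma Ck_on_det m (A : V -> 'M[R]_m) :
  (forall i j, Ck_on k U (fun x => A x i j)) -> Ck_on k U (fun x => \det (A x)).
Proof.
move=> Ak; apply: Ck_on_sum => s _; apply: Ck_onM; first exact: Ck_on_cst.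
by apply: Ck_on_prod => i _; exact: Ak.
Qed.

(** Cramer's rule writes the entries of the inverse as rational functions of
    the entries of the matrix. *)
Lemma Ck_on_invmx (A : V -> 'M[R]_n) :
  (forall x, U x -> A x \in unitmx) ->
  (forall i j, Ck_on k U (fun x => A x i j)) ->
  forall i j, Ck_on k U (fun x => invmx (A x) i j).
Proof.
move=> Au Ak i j.
have detV : Ck_on k U (fun x => (\det (A x))^-1).
  apply: Ck_onV (Ck_on_det Ak) => x Ux.
  by have := Au x Ux; rewrite unitmxE unitfE.
have adjk : Ck_on k U (fun x => \adj (A x) i j).
  apply: (@Ck_on_ext _ _ (fun x => cofactor (A x) j i)) => [x _|].
    by rewrite mxE.
  apply: Ck_onM; first exact: Ck_on_cst.
  apply: Ck_on_det => i' j'.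
  by apply: Ck_on_ext (Ak (lift j i') (lift i j')) => x _; rewrite !mxE.
apply: Ck_on_ext (Ck_onM detV adjk) => x Ux.
by rewrite /invmx Au// !mxE.
Qed.

End Matrices.

Lemma continuous_coordP n (f : V -> 'rV[R]_n) x :
  {for x, continuous f} <-> forall i, {for x, continuous (fun y => f y 0 i)}.
Proof.
split=> [fc i|fc].
  exact: (continuous_comp fc (@coord_continuous _ _ _ _ _ _)).
move=> A [P fP PA].
have : \near x, forall i, P 0 i (f x 0 i).
  by apply: filter_forall => i; exact: fc i _ (fP 0 i).
by apply: filterS => y fy; apply: PA => i j; rewrite (ord1 i).
Qed.

Lemma differentiable_coordP n (f : V -> 'rV[R]_n) x :
  differentiable f x <-> forall i, differentiable (fun y => f y 0 i) x.
Proof.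
split=> [df i|df].
  exact: (differentiable_comp df (differentiable_coord _ _ _)).
have -> : f = \sum_i (fun y => f y 0 i *: delta_mx 0 i).
  apply/funext => y; rewrite [LHS]row_sum_delta.
  by rewrite (big_morph (fun h : V -> 'rV[R]_n => h y) (op1 := +%R) (id1 := 0)).
by apply: differentiable_sum => i; exact: differentiableZl.
Qed.

Lemma derive_coord n (f : V -> 'rV[R]_n) x v i : differentiable f x ->
  'D_v (fun y => f y 0 i) x = 'D_v f x 0 i.
Proof.
move=> df; rewrite deriveE; last by move/differentiable_coordP: df.
have [c cE] : exists c : {linear 'rV[R]_n -> R}, c = (fun N => N 0 i) :> (_ -> _).
  pose c (N : 'rV[R]_n) : R := N 0 i.
  have clin : linear c by move=> a u w; rewrite /c !mxE.
  pose cL := GRing.isLinear.Build _ _ _ _ _ clin.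
  by pose c' : {linear 'rV[R]_n -> R} := HB.pack c cL; exists c'.
have cc : continuous c by rewrite cE; exact: coord_continuous.
have -> : (fun y => f y 0 i) = c \o f by rewrite cE.
have dc := linear_differentiable (f x) cc.
by rewrite diff_comp//= diff_lin// deriveE// cE.
Qed.

Lemma Ck_on_coordP n k (f : V -> 'rV[R]_n) :
  Ck_on k U f <-> forall i, Ck_on k U (fun x => f x 0 i).
Proof.
elim: k f => [|k IHk] f /=; first split=> [fc i x /fc /continuous_coordP//|fc x Ux].
  by apply/continuous_coordP => i; exact: fc.
split=> [[df dfk] i|fk].
  split=> [x Ux|v]; first by move/differentiable_coordP: (df x Ux).
  move/IHk: (dfk v) => /(_ i); apply: Ck_on_ext => x Ux.
  by rewrite derive_coord//; exact: df.
have df x : U x -> differentiable f x.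
  by move=> Ux; apply/differentiable_coordP => i; have [+ _] := fk i; exact.
split=> // v; apply/IHk => i; have [_ /(_ v)] := fk i.
by apply: Ck_on_ext => x Ux; rewrite derive_coord//; exact: df.
Qed.

End CkCalculus.

(** In finite dimension the chain rule expresses a directional derivative of
    [h \o f] through the partial derivatives of [h], which do not depend on the
    point; this is what lets [Ck_on_comp] proceed by induction on [k]. *)
Lemma derive_comp_coord {R : realType} {V : normedModType R} n
    (f : V -> 'rV[R]_n) (h : 'rV[R]_n -> R) x v :
  differentiable f x -> differentiable h (f x) ->
  'D_v (h \o f) x = \sum_i 'D_v f x 0 i * 'D_('e_i) h (f x).
Proof.
move=> df dh; rewrite deriveE; last exact: differentiable_comp.
rewrite diff_comp//= -(deriveE v df) [in LHS](row_sum_delta ('D_v f x)) linear_sum.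
by apply: eq_bigr => i _; rewrite linearZ/= (deriveE _ dh).
Qed.

Lemma Ck_on_comp {R : realType} {V : normedModType R} n k
    (U : set V) (U' : set 'rV[R]_n) (f : V -> 'rV[R]_n) (h : 'rV[R]_n -> R) :
  open U -> open U' -> (forall x, U x -> U' (f x)) ->
  Ck_on k U f -> Ck_on k U' h -> Ck_on k U (h \o f).
Proof.
move=> Uo U'o UU'; elim: k h => [|k IHk] h.
  by move=> fc hc x Ux; apply: continuous_comp; [exact: fc|exact/hc/UU'].
move=> fk hk; have [df dfk] := fk; have [dh dhk] := hk; split=> [x Ux|v].
  by apply: differentiable_comp; [exact: df|exact/dh/UU'].
apply: (@Ck_on_ext _ _ U Uo _ _ (fun x => \sum_i 'D_v f x 0 i * 'D_('e_i) h (f x))).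
  by move=> x Ux; rewrite derive_comp_coord//; [exact: df|exact/dh/UU'].
apply: Ck_on_sum => // i _; apply: Ck_onM => //.
  by move: (dfk v) => /(Ck_on_coordP Uo) /(_ i).
exact: IHk (Ck_onS fk) (dhk 'e_i).
Qed.

Section SecondDerivatives.
Context {R : realType} {n : nat}.
Implicit Types (F : 'rV[R]_n -> R) (x v : 'rV[R]_n).

Definition grad_row F x : 'rV[R]_n := \row_j 'D_('e_j) F x.

Definition hess_mx F x : 'M[R]_n := \matrix_(i, j) 'D_('e_i) ('D_('e_j) F) x.

Lemma derive_grad_row F x v : differentiable F x ->
  'D_v F x = \sum_j v 0 j * grad_row F x 0 j.
Proof.
move=> dF; rewrite (deriveE _ dF) [in LHS](row_sum_delta v) linear_sum.
by apply: eq_bigr => j _; rewrite linearZ/= mxE (deriveE _ dF).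
Qed.

Lemma derive_hess_mx F x v j : differentiable ('D_('e_j) F) x ->
  'D_v ('D_('e_j) F) x = (v *m hess_mx F x) 0 j.
Proof.
move=> dF; rewrite derive_grad_row// mxE.
by apply: eq_bigr => i _; rewrite !mxE.
Qed.

Lemma derive_affine (F1 F2 : 'rV[R]_n -> R) (a : R) x v :
  differentiable F1 x -> differentiable F2 x ->
  'D_v (fun y => F1 y + a * F2 y) x = 'D_v F1 x + a * 'D_v F2 x.
Proof.
move=> dF1 dF2; have d1 := diff_derivable (v := v) dF1.
have d2 := diff_derivable (v := v) dF2.
by rewrite [LHS](deriveD d1 (derivableZ (k := a) d2)) (deriveZ _ d2).
Qed.

Lemma hess_mx_affine (O : set 'rV[R]_n) (F1 F2 : 'rV[R]_n -> R) (a : R) x :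
  open O -> Ck_on 2 O F1 -> Ck_on 2 O F2 -> O x ->
  hess_mx (fun y => F1 y + a * F2 y) x = hess_mx F1 x + a *: hess_mx F2 x.
Proof.
move=> Oo [dF1 d2F1] [dF2 d2F2] Ox; apply/matrixP => i j; rewrite !mxE.
have [[d1 _] [d2 _]] := (d2F1 'e_j, d2F2 'e_j).
rewrite -(derive_affine a _ (d1 x Ox) (d2 x Ox)).
apply: near_eq_derive; apply: (open_near_eq Oo) Ox => y Oy.
by rewrite derive_affine//; [exact: dF1|exact: dF2].
Qed.

End SecondDerivatives.

(** * Charts and coordinate vector fields *)

Section Charts.
Context {R : realType} {n : nat} {M : smooth_manifold R n}.
Implicit Types (c d e : chart R n M) (p : M) (v : 'rV[R]_n).

Local Notation trans c d := (fun x => chart_map d (chart_inv c x)).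

Lemma open_chart_image c (U : set M) : open U ->
  open (chart_map c @` (chart_dom c `&` U)).
Proof.
move=> Uo; rewrite openE => _ [p [cp Up] <-]; rewrite /interior /=.
have imcp : (chart_map c @` chart_dom c) (chart_map c p) by exists p.
near=> y.
have [q cq qy] : (chart_map c @` chart_dom c) y.
  by near: y; apply: open_nbhs_nbhs; split=> //; exact: chart_im_open.
have Uy : U (chart_inv c y).
  near: y; apply: (chart_inv_cont imcp); rewrite chart_mapK//.
  exact: open_nbhs_nbhs.
by exists q => //; split=> //; move: Uy; rewrite -qy chart_mapK.
Unshelve. all: by end_near. Qed.

Lemma near_chart_dom c p d : chart_dom c p -> chart_dom d p ->
  \forall x \near chart_map c p, chart_dom d (chart_inv c x).
Proof.
move=> cp dp; have imcp : (chart_map c @` chart_dom c) (chart_map c p) by exists p.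
apply: (chart_inv_cont imcp); rewrite chart_mapK//.
by apply: open_nbhs_nbhs; split=> //; exact: chart_dom_open.
Qed.

Lemma near_trans_comp (T : Type) (h : M -> T) c d p :
  chart_dom c p -> chart_dom d p ->
  \forall x \near chart_map c p,
    h (chart_inv d (chart_map d (chart_inv c x))) = h (chart_inv c x).
Proof.
move=> cp dp; apply: filterS (near_chart_dom cp dp) => x dx.
by rewrite chart_mapK.
Qed.

Lemma differentiable_trans c d p : chart_around p c -> chart_around p d ->
  differentiable (trans c d) (chart_map c p).
Proof.
move=> [ac cp] [ad dp]; have [+ _] := atlas_smooth ac ad 1.
by apply; exists p.
Qed.

(** Two charts around [p] see the same function through a smooth transition map,
    so that differentials in charts obey the chain rule. With [h] equal to a
    third chart this is the cocycle property of the transition maps. *)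
Lemma diff_trans_comp c d (W : normedModType R) (h : M -> W) p v :
  chart_around p c -> chart_around p d ->
  differentiable (fun x => h (chart_inv d x)) (chart_map d p) ->
  differentiable (fun x => h (chart_inv c x)) (chart_map c p) /\
  'd (fun x => h (chart_inv c x)) (chart_map c p) v =
  'd (fun x => h (chart_inv d x)) (chart_map d p)
    ('d (trans c d) (chart_map c p) v).
Proof.
move=> pc pd dh; have dcd := differentiable_trans pc pd.
have E := near_trans_comp h pc.2 pd.2.
have dh' : differentiable (fun x => h (chart_inv d x))
    (chart_map d (chart_inv c (chart_map c p))).
  by rewrite chart_mapK//; exact: pc.2.
have dcomp := differentiable_comp dcd dh'.
split; first exact: near_eq_differentiable E dcomp.
have dE := congr1 (@^~ v) (near_eq_diff E dcomp).
have dC := congr1 (@^~ v) (diff_comp dcd dh').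
apply: (etrans (esym dE)); apply: (etrans dC).
exact: (congr1 (fun y => 'd (fun x => h (chart_inv d x)) y
  ('d (trans c d) (chart_map c p) v)) (congr1 (chart_map d) (chart_mapK pc.2))).
Qed.

Lemma diff_trans_id c p v : chart_dom c p ->
  'd (trans c c) (chart_map c p) v = v.
Proof.
move=> cp.
have E : \forall x \near chart_map c p, id x = chart_map c (chart_inv c x).
  near=> x; have [q cq <-] : (chart_map c @` chart_dom c) x.
    by near: x; apply: open_nbhs_nbhs; split; [exact: chart_im_open|exists p].
  by rewrite chart_mapK.
by rewrite -(near_eq_diff E) ?diff_val//.
Unshelve. all: by end_near. Qed.

Section Tangent.
Context {p : M}.
Implicit Types u w : tangent p.

Lemma tangent_trans u c d : chart_around p c -> chart_around p d ->
  u d = 'd (trans c d) (chart_map c p) (u c).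
Proof. by case: u => u /= /asboolP[+ _]; exact. Qed.

Lemma tangent_ext c u w : chart_around p c -> u c = w c -> u = w.
Proof.
move=> pc uwc; apply: val_inj; apply/funext => d /=.
have [pd|npd] := pselect (chart_around p d).
  by rewrite (tangent_trans u pc pd) (tangent_trans w pc pd) uwc.
by case: u w uwc => u /= /asboolP[_ u0] [w /= /asboolP[_ w0]] _; rewrite u0// w0.
Qed.

Lemma coords0 c : (0 : tangent p) c = 0. Proof. by []. Qed.

Lemma coordsN c u : (- u) c = - u c. Proof. by []. Qed.

Lemma coordsD c u w : (u + w) c = u c + w c. Proof. by []. Qed.

Lemma coordsZ c (a : R) u : (a *: u) c = a *: u c. Proof. by []. Qed.

Lemma coords_sum c (I : Type) (r : seq I) (F : I -> tangent p) :
  (\sum_(i <- r) F i) c = \sum_(i <- r) F i c.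
Proof. exact: (big_morph (fun u => u c) (coordsD c) (coords0 c)). Qed.

End Tangent.

Definition coord_family c v p : chart R n M -> 'rV[R]_n := fun d =>
  if `[< chart_around p c /\ chart_around p d >]
  then 'd (trans c d) (chart_map c p) v else 0.

Lemma coord_family_tangent c v p : coord_family c v p \in tangent_family p.
Proof.
apply/asboolP; split=> [d e pd pe|d pd]; rewrite /coord_family; last first.
  by case: asboolP => // -[_ /pd].
case: asboolP => [[pc _]|npc]; case: asboolP => [[pc' _]|npc'].
- exact: (diff_trans_comp (h := chart_map e) v pc pd (differentiable_trans pd pe)).2.
- by case: npc'.
- by case: npc.
- by rewrite linear0.
Qed.

(** The vector field with constant coordinates [v] in the chart [c]. A field
    has to be defined everywhere, so it is extended by 0. *)
Definition coord_field c v : vfield M :=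
  fun p => Tangent (coord_family_tangent c v p).

Lemma coord_fieldE c v p d : chart_around p c -> chart_around p d ->
  coord_field c v p d = 'd (trans c d) (chart_map c p) v.
Proof. by move=> pc pd; rewrite /= /coord_family asboolT. Qed.

Lemma coord_field_id c v p : chart_around p c -> coord_field c v p c = v.
Proof. by move=> pc; rewrite coord_fieldE// diff_trans_id//; exact: pc.2. Qed.

Lemma tangent_decomp c p (u : tangent p) : chart_around p c ->
  u = \sum_i u c 0 i *: coord_field c 'e_i p.
Proof.
move=> pc; apply: (tangent_ext pc); rewrite coords_sum [LHS]row_sum_delta.
by apply: eq_bigr => i _; rewrite coordsZ coord_field_id.
Qed.

(** In another chart [d] the field is the derivative of the transition map
    precomposed with the inverse transition, both of which are smooth. *)
Lemma Ck_coord_field k c v : atlas c -> Ck_vfield k (chart_dom c) (coord_field c v).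
Proof.
move=> ac d ad; have Uo := open_chart_image (c := d) (chart_dom_open c).
have U'o := open_chart_image (c := c) (chart_dom_open d).
apply: (Ck_on_ext Uo (f := fun x => 'D_v (trans c d) (chart_map c (chart_inv d x)))).
  move=> _ [p [dp cp] <-]; rewrite chart_mapK// coord_fieldE//.
  by rewrite deriveE//; exact: differentiable_trans.
apply/(Ck_on_coordP Uo) => i.
apply: (Ck_on_comp (U' := chart_map c @` (chart_dom c `&` chart_dom d))
  (h := fun y => 'D_v (trans c d) y 0 i)) => //.
- by move=> _ [p [dp cp] <-]; rewrite chart_mapK//; exists p.
- exact: atlas_smooth.
- have [_ /(_ v)] := atlas_smooth ac ad k.+1.
  by move/(Ck_on_coordP U'o).
Qed.

Lemma dfunE (f : M -> R) p c (xi : tangent p) : chart_around p c ->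
  differentiable (fun x => f (chart_inv c x)) (chart_map c p) ->
  dfun f xi = 'd (fun x => f (chart_inv c x)) (chart_map c p) (xi c).
Proof.
move=> pc df; have pd : chart_around p (pref_chart p).
  by rewrite /pref_chart; case: cid.
apply: (etrans (diff_trans_comp (h := f) (xi (pref_chart p)) pd pc df).2).
exact: congr1 (esym (tangent_trans xi pd pc)).
Qed.

Lemma Ck_fun_differentiable k (f : M -> R) p c : Ck_fun k.+1 [set: M] f ->
  chart_around p c ->
  differentiable (fun x => f (chart_inv c x)) (chart_map c p).
Proof. by move=> fk [ac cp]; have [+ _] := fk c ac; apply; exists p. Qed.

End Charts.

(** * Gradient and Hessian in a chart *)

Section Gradient.
Context {R : realType} {n : nat} {M : smooth_manifold R n}.
Variable g : riemannian_metric M.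
Implicit Types (c d : chart R n M) (p : M).

Lemma metric0 p (w : tangent p) : g p 0 w = 0.
Proof.
have := metric_linear g 1 0 0 w; rewrite scale1r addr0 mul1r => /eqP.
by rewrite -subr_eq0 opprD addrA subrr sub0r oppr_eq0 => /eqP.
Qed.

Lemma metric_suml p (I : Type) (r : seq I) (a : I -> R) (F : I -> tangent p)
    (w : tangent p) :
  g p (\sum_(i <- r) a i *: F i) w = \sum_(i <- r) a i * g p (F i) w.
Proof.
elim: r => [|i r IHr]; first by rewrite !big_nil metric0.
by rewrite !big_cons metric_linear IHr.
Qed.

Lemma metric_inj p (u w : tangent p) : (forall xi, g p u xi = g p w xi) -> u = w.
Proof.
move=> uw; apply/eqP; rewrite -subr_eq0; apply/negPn/negP => /(metric_pos g).
have -> : u - w = (-1) *: w + u by rewrite scaleN1r addrC.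
by rewrite metric_linear uw mulN1r addNr ltxx.
Qed.

Lemma metric_inj_coord c p (u w : tangent p) : chart_around p c ->
  (forall j, g p u (coord_field c 'e_j p) = g p w (coord_field c 'e_j p)) ->
  u = w.
Proof.
move=> pc uw; apply: metric_inj => xi.
rewrite !(Defs.metric_sym g _ xi) (tangent_decomp xi pc) !metric_suml.
by apply: eq_bigr => j _; rewrite !(Defs.metric_sym g (coord_field _ _ _)) uw.
Qed.

(** The matrix of the metric in the chart [c]. *)
Definition gram c p : 'M[R]_n :=
  \matrix_(i, j) g p (coord_field c 'e_i p) (coord_field c 'e_j p).

Lemma metric_gram p c (u w : tangent p) : chart_around p c ->
  g p u w = (u c *m gram c p *m (w c)^T) 0 0.
Proof.
move=> pc; rewrite {1}(tangent_decomp u pc) metric_suml -mulmxA mxE.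
apply: eq_bigr => i _; congr (_ * _).
rewrite Defs.metric_sym {1}(tangent_decomp w pc) metric_suml mxE.
by apply: eq_bigr => j _; rewrite !mxE mulrC Defs.metric_sym.
Qed.

Lemma gram_unitmx p c : chart_around p c -> gram c p \in unitmx.
Proof.
move=> pc; rewrite -row_free_unit; apply: inj_row_free => v vG.
suff : coord_field c v p = 0.
  by move=> /(congr1 (fun u : tangent p => u c)); rewrite coord_field_id.
apply/eqP/negPn/negP => /(metric_pos g).
by rewrite (metric_gram _ _ pc) coord_field_id// vG mul0mx mxE ltxx.
Qed.

(** Smoothness of a metric is a statement about pairs of smooth vector fields;
    coordinate fields turn it into one about matrix entries. *)
Lemma Ck_gram k c i j : atlas c ->
  Ck_on k (chart_map c @` chart_dom c) (fun x => gram c (chart_inv c x) i j).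
Proof.
move=> ac; have Uo := open_chart_image (c := c) (chart_dom_open c).
rewrite setIid in Uo.
apply: (Ck_on_ext Uo (f := fun x => g (chart_inv c x)
    (coord_field c 'e_i (chart_inv c x)) (coord_field c 'e_j (chart_inv c x)))).
  by move=> x _; rewrite mxE.
rewrite -(setIid (chart_dom c)).
have Ek v k' := Ck_coord_field k' v ac.
exact: (metric_smooth g (chart_dom_open c) (Ek 'e_i) (Ek 'e_j) _ ac).
Qed.

Section GradientAt.
Variables (f : M -> R) (p : M) (c : chart R n M).
Hypothesis pc : chart_around p c.
Hypothesis df : differentiable (fun x => f (chart_inv c x)) (chart_map c p).

(** The Riesz representative exists because the matrix of the metric is
    invertible: these are its coordinates. *)
Lemma metric_coord_grad (xi : tangent p) :
  g p (coord_field c (grad_row (fun x => f (chart_inv c x)) (chart_map c p)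
         *m invmx (gram c p)) p) xi = dfun f xi.
Proof.
rewrite (metric_gram _ _ pc) coord_field_id// mulmxKV; last exact: gram_unitmx.
rewrite (dfunE _ pc df) -(deriveE _ df) (derive_grad_row _ df) mxE.
by apply: eq_bigr => i _; rewrite mulrC [in LHS]mxE.
Qed.

Lemma metric_grad (xi : tangent p) : g p (grad g f p) xi = dfun f xi.
Proof.
rewrite /grad; case: xgetP => [G _ GE|no]; first exact: GE.
by have := no _ metric_coord_grad.
Qed.

Lemma grad_coord : grad g f p c =
  grad_row (fun x => f (chart_inv c x)) (chart_map c p) *m invmx (gram c p).
Proof.
rewrite -[RHS](coord_field_id _ pc); congr (coords _ c); apply: metric_inj => xi.
by rewrite metric_grad metric_coord_grad.
Qed.

End GradientAt.

Lemma Ck_grad k (f : M -> R) :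
  Ck_fun k.+1 [set: M] f -> Ck_vfield k [set: M] (grad g f).
Proof.
move=> fk c ac; have [df dfk] := fk c ac; rewrite setIT in df dfk *.
set U := chart_map c @` chart_dom c; have Uo : open U := @chart_im_open _ _ _ c.
have UE x : U x -> exists2 p, chart_around p c & chart_map c p = x.
  by move=> [p cp <-]; exists p.
apply/(Ck_on_coordP Uo) => j.
apply: (Ck_on_ext Uo (f := fun x => \sum_i
  'D_('e_i) (fun x => f (chart_inv c x)) x * invmx (gram c (chart_inv c x)) i j)).
  move=> _ /UE[p pc <-]; rewrite (chart_mapK pc.2) (grad_coord pc); last first.
    by apply: df; exists p => //; exact: pc.2.
  by rewrite mxE; apply: eq_bigr => i _; rewrite mxE.
apply: Ck_on_sum => // i _; apply: Ck_onM => //.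
  by have := dfk 'e_i.
apply: (Ck_on_invmx Uo (A := fun x => gram c (chart_inv c x))).
  by move=> _ /UE[p pc <-]; rewrite (chart_mapK pc.2) gram_unitmx.
by move=> i' j'; exact: Ck_gram.
Qed.

End Gradient.

Section Hessian.
Context {R : realType} {n : nat} {M : smooth_manifold R n}.
Variables (g : riemannian_metric M) (nabla : connection M).
Hypothesis nabla_LC : levi_civita g nabla.
Variables (f : M -> R) (p : M) (c : chart R n M).
Hypothesis f_C2 : Ck_fun 2 [set: M] f.
Hypothesis pc : chart_around p c.

Lemma grad_critical :
  (forall v, 'D_v (fun x => f (chart_inv c x)) (chart_map c p) = 0) ->
  grad g f p = 0.
Proof.
move=> crit; have df := Ck_fun_differentiable f_C2 pc.
apply: (metric_inj (g := g)) => xi.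
by rewrite metric0 (metric_grad _ pc df) (dfunE _ pc df) -(deriveE _ df).
Qed.

(** In the metric compatibility formula for the gradient and the coordinate
    field, the covariant derivative of the coordinate field is paired with the
    gradient, which vanishes at a critical point: no Christoffel symbol
    survives. *)
Lemma Hess_critical (xi : tangent p) v :
  (forall v, 'D_v (fun x => f (chart_inv c x)) (chart_map c p) = 0) ->
  g p (Hess g nabla f p xi) (coord_field c v p) =
  'D_(xi c) (fun y => 'D_v (fun x => f (chart_inv c x)) y) (chart_map c p).
Proof.
move=> crit; have [ac cp] := pc; have [_ compat] := nabla_LC.
have [df dfk] := f_C2 ac; rewrite setIT in df dfk.
have Uo : open (chart_map c @` chart_dom c) := @chart_im_open _ _ _ c.
have Ycp : (chart_map c @` chart_dom c) (chart_map c p) by exists p.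
have := compat (chart_dom c) (grad g f) (coord_field c v) (chart_dom_open c) _
  (Ck_coord_field 1 v ac) p cp xi.
rewrite (grad_critical crit) metric0 addr0 => <-; last first.
  move=> d ad; apply: Ck_on_subset (Ck_grad g f_C2 ad) => _ [q [dq _] <-].
  by exists q.
(* <grad f, E> = df(E) near p, and df(E) is a partial derivative in c. *)
have hE : \forall y \near chart_map c p, 'D_v (fun x => f (chart_inv c x)) y =
    g (chart_inv c y) (grad g f (chart_inv c y)) (coord_field c v (chart_inv c y)).
  apply: (@open_near_eq _ _ _ Uo) => // _ [q cq <-]; rewrite (chart_mapK cq).
  have qc : chart_around q c by [].
  rewrite (metric_grad _ qc (Ck_fun_differentiable f_C2 qc)).
  rewrite (dfunE _ qc (Ck_fun_differentiable f_C2 qc)) coord_field_id//.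
  by rewrite deriveE//; exact: Ck_fun_differentiable f_C2 qc.
have dD : differentiable ('D_v (fun x => f (chart_inv c x))) (chart_map c p).
  by have [+ _] := dfk v; exact.
rewrite (dfunE _ pc); last exact: near_eq_differentiable hE dD.
by rewrite (deriveE _ dD) (near_eq_diff hE dD).
Qed.

Hypothesis crit :
  forall v, 'D_v (fun x => f (chart_inv c x)) (chart_map c p) = 0.

Lemma Hess_critical_coord (xi : tangent p) j :
  g p (Hess g nabla f p xi) (coord_field c 'e_j p) =
  (xi c *m hess_mx (fun x => f (chart_inv c x)) (chart_map c p)) 0 j.
Proof.
rewrite Hess_critical// derive_hess_mx//; have [ac cp] := pc.
by have [_ /(_ 'e_j)[+ _]] := f_C2 ac; apply; exists p.
Qed.

(** A kernel vector of the matrix would be the coordinates of a tangent vector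
    whose Hessian is orthogonal to all coordinate fields. *)
Lemma hess_mx_unitmx : injective (Hess g nabla f p) ->
  hess_mx (fun x => f (chart_inv c x)) (chart_map c p) \in unitmx.
Proof.
move=> Hinj; rewrite -row_free_unit; apply: inj_row_free => w wH.
suff /(congr1 (fun u : tangent p => u c)) : coord_field c w p = 0.
  by rewrite coord_field_id.
apply: Hinj; rewrite linear0; apply: (metric_inj_coord (g := g) pc) => j.
by rewrite metric0 Hess_critical_coord coord_field_id// wH mxE.
Qed.

End Hessian.

(** * Minimizers and curves of critical points *)

Section LocalMinimum.
Context {R : realType} {V : normedModType R}.

Lemma derive_ge0_at_min (f : V -> R) (x v : V) :
  derivable f x v -> (\forall y \near x, f x <= f y) -> 0 <= 'D_v f x.
Proof.
move=> df fmin; rewrite /derive cvg_at_rightE//.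
have dfr := cvg_dnbhs_at_right df.
apply: limr_ge; first exact: cvgP dfr.
have xc : (fun h : R => h *: v + x) @ 0^'+ --> x.
  apply: cvg_dnbhs_at_right; apply: cvg_within_filter.
  have : (fun h : R => h *: v + x) @ 0 --> 0 *: v + x.
    by apply: cvgD; [apply: cvgZ; [exact: cvg_id|exact: cvg_cst]|exact: cvg_cst].
  by rewrite scale0r add0r.
near=> h; apply: mulr_ge0.
  by rewrite invr_ge0; near: h; exact: nbhs_right_ge.
rewrite subr_ge0 /=; near: h; exact: xc _ fmin.
Unshelve. all: by end_near. Qed.

Lemma derive_eq0_at_min (f : V -> R) (x v : V) :
  differentiable f x -> (\forall y \near x, f x <= f y) -> 'D_v f x = 0.
Proof.
move=> df fmin; apply/eqP; rewrite eq_le -oppr_ge0; apply/andP; split.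
  have -> : - 'D_v f x = 'D_(- v) f x by rewrite !(deriveE _ df) linearN.
  by apply: derive_ge0_at_min fmin; exact: diff_derivable.
by apply: derive_ge0_at_min fmin; exact: diff_derivable.
Qed.

End LocalMinimum.

(** Let [q] be the difference quotient of [x] and [m] the value of [- k] along the
    curve. The first-order expansion of [K] at [x t] bounds [q - m] by an
    arbitrarily small multiple of [q], once the continuity of [x] has made the
    increments small. With the factor 1/2 this bounds [q]; then an arbitrary
    factor shows that [q] has the same limit as [m]. *)
Lemma is_derive_zero_curve {R : realType} {V : normedModType R}
    (K k : V -> V) (x : R -> V) (t : R) :
  {for t, continuous x} -> {for x t, continuous k} ->
  differentiable K (x t) -> 'd K (x t) = id :> (V -> V) ->
  (\forall s \near t, K (x s) = (t - s) *: k (x s)) ->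
  is_derive t 1 x (- k (x t)).
Proof.
move=> xc kc dK dKid Kx.
have Kx0 : K (x t) = 0 by rewrite (nbhs_singleton Kx) subrr scale0r.
pose q (h : R) := h^-1 *: ((x \o shift t) (h *: 1) - x t).
pose m (h : R) := - k (x (h + t)).
have shc : (fun h : R => h + t) @ 0^' --> t.
  apply: cvg_within_filter.
  have : (fun h : R => h + t) @ 0 --> 0 + t.
    by apply: cvgD; [exact: cvg_id|exact: cvg_cst].
  by rewrite add0r.
have xhc : (fun h => x (h + t)) @ 0^' --> x t by exact: cvg_comp shc xc.
have mc : m @ 0^' --> - k (x t) by apply: cvgN; exact: cvg_comp xhc kc.
have est e : 0 < e -> \forall h \near 0^', `|q h - m h| <= e * `|q h|.
  move=> e0; have /eqaddoP /(_ e e0) := diff_locally dK; rewrite dKid.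
  have x0c : (fun h => x (h + t) - x t) @ 0^' --> 0.
    by rewrite -(subrr (x t)); apply: cvgB => //; exact: cvg_cst.
  move=> /x0c /= Ke; near=> h.
  have h0 : h != 0 by near: h; exact: nbhs_dnbhs_neq.
  have hq : x (h + t) - x t = h *: q h.
    by rewrite /q scalerA mulfV// scale1r /= [h *: 1]mulr1.
  have Kh : K (x (h + t)) = h *: m h.
    rewrite /m; have -> : K (x (h + t)) = (t - (h + t)) *: k (x (h + t)).
      by near: h; exact: shc _ Kx.
    by rewrite opprD addrCA subrr addr0 scaleNr scalerN.
  have : `|K (x (h + t) - x t + x t) - (K (x t) + (x (h + t) - x t))|
      <= e * `|x (h + t) - x t| by near: h; exact: Ke.
  rewrite subrK Kx0 add0r hq Kh -scalerBr !normrZ distrC mulrCA.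
  by rewrite ler_pM2l// normr_gt0.
have qc : q @ 0^' --> - k (x t).
  apply: (cvg_sub0 _ mc); apply/cvgr0Pnorm_le => e e0.
  pose C : R := 2 * (`|k (x t)| + 1).
  have C0 : 0 < C by rewrite mulr_gt0// ltr_wpDl.
  near=> h.
  have qC : `|q h| <= C.
    have mb : `|m h| <= `|k (x t)| + 1.
      rewrite -[X in `|X| <= _](subrK (- k (x t))) addrC -(normrN (k (x t))).
      apply: (le_trans (ler_normD _ _)); rewrite lerD2l.
      by near: h; exact: (cvgr_distC_le _ _ mc _ ltr01).
    have qm : `|q h - m h| <= 2^-1 * `|q h| by near: h; apply: est.
    have : `|q h| <= `|q h - m h| + `|m h|.
      by rewrite -[X in `|X| <= _](subrK (m h)) ler_normD.
    rewrite /C; lra.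
  apply: (@le_trans _ _ (e / C * `|q h|)).
    by near: h; apply: est; rewrite divr_gt0.
  by rewrite -mulrA ler_piMr// ?(ltW e0)// mulrC ler_pdivrMr// mul1r.
by apply: DeriveDef; [exact: cvgP qc|exact: cvg_lim qc].
Unshelve. all: by end_near. Qed.

(** Any cluster point of the minimizers is itself a minimizer for the limit
    parameter, hence the unique one; compactness turns this into convergence. *)
Lemma argmin_continuous {R : realType} {P T : topologicalType}
    (F : P -> T -> R) (gamma : P -> T) (mu : P) :
  hausdorff_space T -> compact [set: T] ->
  (forall p, {for (mu, p), continuous (fun z : P * T => F z.1 z.2)}) ->
  (\forall s \near mu, forall y, F s (gamma s) <= F s y) ->
  (forall q, (forall y, F mu q <= F mu y) -> q = gamma mu) ->
  {for mu, continuous gamma}.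
Proof.
move=> TH Tc Fc gmin guniq.
have clust q : cluster (gamma @ mu) q -> q = gamma mu.
  move=> clq; apply: guniq => y; rewrite leNgt; apply/negP => yq.
  have Fyc : {for (mu, q), continuous (fun z : P * T => F z.1 y)}.
    have pc : {for (mu, q), continuous (fun z : P * T => (z.1, y))}.
      by apply: cvg_pair; [exact: cvg_fst|exact: cvg_cst].
    exact: (continuous_comp pc (Fc y)).
  have dc : {for (mu, q), continuous (fun z : P * T => F z.1 z.2 - F z.1 y)}.
    by apply: cvgB; [exact: Fc|exact: Fyc].
  have dpos : \forall z \near (mu, q), 0 < F z.1 z.2 - F z.1 y.
    by apply: cvgr_gt dc _ _; rewrite subr_gt0.
  (* A parameter near mu whose minimizer is near q would do worse than y. *)
  have [[A B] /= [Amu Bq] AB] := dpos.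
  have AG : (gamma @ mu) (gamma @` (A `&` [set s | forall y, F s (gamma s) <= F s y])).
    by apply: filterS (filterI Amu gmin) => s As; exists s.
  have [_ [[s [As smin] <-] Bs]] := clq _ _ AG Bq.
  have /= := AB (s, gamma s) (conj As Bs).
  by rewrite subr_gt0 ltNge smin.
apply: (compact_cluster_set1 TH Tc); [exact: filterT|exact: filterT|].
apply/seteqP; split=> [q /clust//|_ ->].
have [q [_ clq]] := Tc (gamma @ mu) _ filterT.
by rewrite -(clust q clq).
Qed.

Section CriticalCurve.
Context {R : realType} {n : nat}.
Variables (O : set 'rV[R]_n) (F1 F2 : 'rV[R]_n -> R) (D : set R).
Variable (x : R -> 'rV[R]_n).
Hypotheses (Oo : open O) (F1_C2 : Ck_on 2 O F1) (F2_C2 : Ck_on 2 O F2).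
Hypotheses (Do : open D) (xO : forall s, D s -> O (x s)).
Hypothesis xc : Ck_on 0 D x.

Let Phi s : 'rV[R]_n -> R := fun y => F1 y + s * F2 y.

Hypothesis x_crit : forall s v, D s -> 'D_v (Phi s) (x s) = 0.
Hypothesis x_nondeg : forall s, D s -> hess_mx (Phi s) (x s) \in unitmx.

Let Phi_C2 s : Ck_on 2 O (Phi s).
Proof. exact: (Ck_onD Oo F1_C2 (Ck_onM Oo (Ck_on_cst Oo 2 s) F2_C2)). Qed.

Lemma critical_curve_derive t : D t ->
  is_derive t 1 x (- (grad_row F2 (x t) *m invmx (hess_mx (Phi t) (x t)))).
Proof.
move=> Dt; set B := invmx _; have Oxt := xO Dt.
have [dF1 d2F1] := F1_C2; have [dF2 d2F2] := F2_C2.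
pose mulB (f : 'rV[R]_n -> 'rV[R]_n) y := f y *m B.
have mulB_Ck k f : Ck_on k O f -> Ck_on k O (mulB f).
  move=> fk; apply/(Ck_on_coordP Oo) => i.
  apply: (Ck_on_ext Oo (f := fun y => \sum_j f y 0 j * B j i)).
    by move=> y _; rewrite [RHS]mxE.
  apply: Ck_on_sum => // j _; apply: Ck_onM => //; last exact: Ck_on_cst.
  by move/(Ck_on_coordP Oo) : fk.
have grad_Ck F : Ck_on 2 O F -> Ck_on 1 O (grad_row F).
  move=> [_ d2F]; apply/(Ck_on_coordP Oo) => j.
  by apply: (Ck_on_ext Oo (f := 'D_('e_j) F)) => [y _|]; [rewrite mxE|exact: d2F].
have dgrad := (grad_Ck _ (Phi_C2 t)).1.
have dK := (mulB_Ck _ _ (grad_Ck _ (Phi_C2 t))).1 (x t) Oxt.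
have dk2 := (mulB_Ck _ _ (grad_Ck _ F2_C2)).1.
have Dgrad w : 'D_w (grad_row (Phi t)) (x t) = w *m hess_mx (Phi t) (x t).
  apply/rowP => j; rewrite -derive_coord; last exact: dgrad.
  have -> : (fun y => grad_row (Phi t) y 0 j) = 'D_('e_j) (Phi t).
    by apply/funext => y; rewrite mxE.
  by rewrite derive_hess_mx//; have [_ /(_ 'e_j)[+ _]] := Phi_C2 t; exact.
(* Multiplying the gradient by B normalizes its differential to the identity. *)
apply: (is_derive_zero_curve (K := mulB (grad_row (Phi t)))
  (k := mulB (grad_row F2)) (x := x) (t := t)); first last.
(* x s is critical for Phi s, which differs from Phi t by (s - t) F2. *)
- near=> s; have Ds : D s by near: s; exact: open_nbhs_nbhs.
  rewrite /mulB scalemxAl; congr (_ *m _); apply/rowP => j; rewrite !mxE.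
  have := x_crit 'e_j Ds; rewrite /Phi !derive_affine; first last.
  + by apply: dF2; exact: xO.
  + by apply: dF1; exact: xO.
  + by apply: dF2; exact: xO.
  + by apply: dF1; exact: xO.
  by lra.
- apply/funext => w; rewrite -(deriveE _ dK).
  apply/rowP => i; rewrite -derive_coord//.
  have dj j : differentiable (fun y => grad_row (Phi t) y 0 j) (x t).
    by have /differentiable_coordP := dgrad _ Oxt.
  have -> : (fun y => mulB (grad_row (Phi t)) y 0 i) =
      \sum_j (B j i \*: (fun y => grad_row (Phi t) y 0 j)).
    apply/funext => y; rewrite mxE.
    rewrite (big_morph (fun h : 'rV[R]_n -> R => h y) (op1 := +%R) (id1 := 0))//.
    by apply: eq_bigr => j _; rewrite mulrC.
  rewrite derive_sum => [|j]; last exact/derivableZ/diff_derivable.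
  transitivity ((w *m hess_mx (Phi t) (x t) *m B) 0 i).
    rewrite [RHS]mxE; apply: eq_bigr => j _.
    rewrite (deriveZ _ (diff_derivable (dj j))) derive_coord; last exact: dgrad.
    by rewrite Dgrad; exact: mulrC.
  by rewrite mulmxK// x_nondeg.
- exact: dK.
- exact: (differentiable_continuous (dk2 _ Oxt)).
- exact: (xc Dt).
Unshelve. all: by end_near. Qed.

Lemma critical_curve_C1 : Ck_on 1 D x.
Proof.
have dx t : D t -> differentiable x t.
  move=> Dt; apply/derivable1_diffP; have ? := critical_curve_derive Dt.
  exact: ex_derive.
split=> // v.
apply: (Ck_on_ext Do (f := fun s =>
    - (v *: (grad_row F2 (x s) *m invmx (hess_mx (Phi s) (x s)))))).
  move=> t Dt; have -> : 'D_v x t = v *: 'D_1 x t.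
    by rewrite !(deriveE _ (dx t Dt)) -linearZ/= [v *: 1]mulr1.
  by have ? := critical_curve_derive Dt; rewrite derive_val scalerN.
have compx (h : 'rV[R]_n -> R) : Ck_on 0 O h -> Ck_on 0 D (h \o x).
  exact: Ck_on_comp Do Oo xO xc.
apply/(Ck_on_coordP Do) => i.
apply: (Ck_on_ext Do (f := fun s => - v * \sum_j
    'D_('e_j) F2 (x s) * invmx (hess_mx F1 (x s) + s *: hess_mx F2 (x s)) j i)).
  move=> s Ds; rewrite !mxE mulNr; congr (- (_ * _)); apply: eq_bigr => j _.
  by rewrite (hess_mx_affine s Oo F1_C2 F2_C2 (xO Ds)) mxE.
have hess_C0 F k l : Ck_on 2 O F -> Ck_on 0 D (fun s => hess_mx F (x s) k l).
  move=> [_ /(_ 'e_l)[_ /(_ 'e_k) F0]].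
  by apply: Ck_on_ext (compx _ F0) => // s _; rewrite mxE.
apply: Ck_onM; [exact: Do|exact: Ck_on_cst|].
apply: Ck_on_sum => // j _; apply: Ck_onM => //.
  apply: (compx ('D_('e_j) F2)); have [_ /(_ 'e_j)[d2F2 _]] := F2_C2.
  by move=> y Oy; exact: differentiable_continuous (d2F2 y Oy).
apply: (Ck_on_invmx Do (A := fun s => hess_mx F1 (x s) + s *: hess_mx F2 (x s))).
  by move=> s Ds; rewrite -(hess_mx_affine s Oo F1_C2 F2_C2 (xO Ds)) x_nondeg.
move=> k l; apply: (Ck_on_ext Do (f := fun s =>
    hess_mx F1 (x s) k l + s * hess_mx F2 (x s) k l)).
  by move=> s _; rewrite !mxE.
apply: Ck_onD => //; first exact: hess_C0.
by apply: Ck_onM => //; [move=> s _; exact: cvg_id|exact: hess_C0].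
Qed.

End CriticalCurve.

(** * The curve of minimizers on the manifold *)

Lemma Ck_fun_continuous {R : realType} {n : nat} {M : smooth_manifold R n} k
    (f : M -> R) : Ck_fun k.+1 [set: M] f -> continuous f.
Proof.
move=> fk p; have [c pc] := atlas_cover p; have [ac cp] := pc.
have fc := differentiable_continuous (Ck_fun_differentiable fk pc).
have fcc : {for p, continuous (fun q => f (chart_inv c (chart_map c q)))}.
  exact: continuous_comp (chart_map_cont cp) fc.
have := fcc; rewrite /prop_for/continuous_at chart_mapK//.
apply: cvg_trans; apply: near_eq_cvg.
have : \forall q \near p, chart_dom c q.
  by apply: open_nbhs_nbhs; split=> //; exact: chart_dom_open.
by apply: filterS => q cq; rewrite chart_mapK.
Qed.

Theorem lemma5 (R : realType) (n : nat) (M : smooth_manifold R n)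
    (g : riemannian_metric M)
    (nabla : connection M) (nabla_LC : levi_civita g nabla)
    (M_compact : compact [set: M])
    (f1 f2 : M -> R)
    (f1_C2 : Ck_fun 2 [set: M] f1) (f2_C2 : Ck_fun 2 [set: M] f2)
    (phi : R -> M -> R)
    (phiE : forall mu, phi mu = fun x => f1 x + mu * f2 x)
    (gamma : R -> M)
    (gamma_argmin : forall mu, 0 < mu -> argmin (phi mu) = [set gamma mu])
    (Hess_inv : forall mu, 0 < mu ->
      bijective (Hess g nabla (phi mu) (gamma mu))) :
  C1_curve [set mu : R | 0 < mu] gamma /\
  (forall mu, 0 < mu ->
    has_velocity
      (- tangent_inv (Hess g nabla (phi mu) (gamma mu))
           (grad g f2 (gamma mu)))).
Proof.
have phi_C2 mu : Ck_fun 2 [set: M] (phi mu).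
  move=> c ac; rewrite phiE.
  have Uo := open_chart_image (c := c) (@openT M).
  apply: Ck_onD => //; first exact: f1_C2.
  by apply: Ck_onM => //; [exact: Ck_on_cst|exact: f2_C2].
have gamma_min mu : 0 < mu -> forall y, phi mu (gamma mu) <= phi mu y.
  by move=> mu0; have : argmin (phi mu) (gamma mu) by rewrite gamma_argmin.
have gt0_open : open [set mu : R | 0 < mu] := @open_gt R 0.
have gamma_cont mu : 0 < mu -> {for mu, continuous gamma}.
  move=> mu0; apply: (argmin_continuous (F := phi)) => //.
  - exact: carrier_hausdorff.
  - move=> p; rewrite (_ : (fun z : R * M => _) = fun z => f1 z.2 + z.1 * f2 z.2).
      have c2 f : Ck_fun 2 [set: M] f ->
          {for (mu, p), continuous (fun z : R * M => f z.2)}.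
        by move=> fk; apply: continuous_comp; [exact: cvg_snd|
          exact: (Ck_fun_continuous fk)].
      apply: cvgD; first exact: c2.
      by apply: cvgM; [exact: cvg_fst|exact: c2].
    by apply/funext => z; rewrite phiE.
  - have : \forall s \near mu, 0 < s by exact: open_nbhs_nbhs.
    by apply: filterS => s; exact: gamma_min.
  - move=> q qmin; have : argmin (phi mu) q by [].
    by rewrite gamma_argmin.
(* On D c the curve can be read in the chart c. *)
pose D (c : chart R n M) := [set mu : R | 0 < mu] `&` gamma @^-1` chart_dom c.
pose F (f : M -> R) (c : chart R n M) (x : 'rV[R]_n) : R := f (chart_inv c x).
have FE mu c : (fun y => F f1 c y + mu * F f2 c y) = F (phi mu) c.
  by apply/funext => y; rewrite /F phiE.
have D_open c : open (D c).
  rewrite openE => s [s0 cs]; apply: filterI; first exact: open_nbhs_nbhs.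
  by apply: (gamma_cont s s0); apply: open_nbhs_nbhs; split=> //; exact: chart_dom_open.
have crit mu c v : atlas c -> D c mu ->
    'D_v (F (phi mu) c) (chart_map c (gamma mu)) = 0.
  move=> ac [mu0 cmu]; apply: derive_eq0_at_min.
    exact: (Ck_fun_differentiable (phi_C2 mu)).
  by apply: filterE => y; rewrite /F chart_mapK// gamma_min.
have nondeg mu c : atlas c -> D c mu ->
    hess_mx (F (phi mu) c) (chart_map c (gamma mu)) \in unitmx.
  move=> ac Dmu; have [mu0 cmu] := Dmu.
  have pc : chart_around (gamma mu) c by [].
  exact: (hess_mx_unitmx nabla_LC (phi_C2 mu) pc (fun v => crit mu c v ac Dmu)
    (bij_inj (Hess_inv mu mu0))).
have FC2 f c : Ck_fun 2 [set: M] f -> atlas c ->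
    Ck_on 2 (chart_map c @` chart_dom c) (F f c).
  by move=> fk ac; have := fk c ac; rewrite setIT.
have xc c : Ck_on 0 (D c) (fun s => chart_map c (gamma s)).
  move=> s [s0 cs]; apply: continuous_comp; first exact: gamma_cont.
  exact: chart_map_cont.
have xO c s : D c s -> (chart_map c @` chart_dom c) (chart_map c (gamma s)).
  by move=> [_ cs]; exists (gamma s).
have crit' c (ac : atlas c) s v : D c s ->
    'D_v (fun y => F f1 c y + s * F f2 c y) (chart_map c (gamma s)) = 0.
  by rewrite FE; exact: crit.
have nondeg' c (ac : atlas c) s : D c s ->
    hess_mx (fun y => F f1 c y + s * F f2 c y) (chart_map c (gamma s)) \in unitmx.
  by rewrite FE; exact: nondeg.
split; [split=> [t|c ac]|move=> mu mu0 c pc].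
- exact: gamma_cont.
- exact: (critical_curve_C1 (@chart_im_open _ _ _ c) (FC2 _ _ f1_C2 ac)
    (FC2 _ _ f2_C2 ac) (D_open c) (xO c) (xc c) (crit' c ac) (nondeg' c ac)).
have [ac cmu] := pc; have Dmu : D c mu by [].
apply: (is_derive_eq (critical_curve_derive (@chart_im_open _ _ _ c)
  (FC2 _ _ f1_C2 ac) (FC2 _ _ f2_C2 ac) (D_open c) (xO c) (xc c) (crit' c ac)
  (nondeg' c ac) Dmu)).
rewrite coordsN FE; congr (- _).
set xi := tangent_inv _ _.
have Hxi : Hess g nabla (phi mu) (gamma mu) xi = grad g f2 (gamma mu).
  have [Hi _ HiK] := Hess_inv mu mu0.
  apply: (pinvK (fun=> 0) (A := setT)); rewrite inE.
  by exists (Hi (grad g f2 (gamma mu))) => //; exact: HiK.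
(* Both sides are compared after multiplication by the Hessian matrix, where the
   right-hand one becomes the pairing of Hess xi with the coordinate fields. *)
apply: (canLR (mulmxK (nondeg mu c ac Dmu))); apply/rowP => j.
rewrite -(Hess_critical_coord nabla_LC (phi_C2 mu) pc); last first.
  by move=> v; exact: crit.
have df2 := Ck_fun_differentiable f2_C2 pc.
rewrite Hxi (metric_grad _ pc df2) (dfunE _ pc df2) coord_field_id// mxE.
by rewrite deriveE.
Qed.
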